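(* Let $p$ be a prime number, let $k$ be a natural number with $2^{k}<p$, and let $(A,+,\cdot)$ be a nilpotent pre-Lie algebra over $\mathbb{F}_{p}$ of nilpotency index $k$. Let $(A,+,\circ)$ be the brace which is the group of flows of $(A,+,\cdot)$, and write $a*b=a\circ b-a-b$. Then the brace $(A,+,\circ)$ has nilpotency index $k$. Moreover, for all $a,b\in A$, $$a\cdot b=-\sum_{i=0}^{p-2}\frac{1}{2^{i}}\bigl((2^{i}a)*b\bigr),$$ where $2^{i}a$ denotes the sum of $2^{i}$ copies of $a$ and $\frac{1}{2^{i}}$ denotes the inverse of $2^{i}$ in $\mathbb{F}_{p}$.
   Context: A left brace is a set $A$ with operations $+,\circ$ such that $(A,+)$ is an abelian group, $(A,\circ)$ is a group, and $a\circ(b+c)+a=a\circ b+a\circ c$ for all $a,b,c\in A$. One writes $a*b=a\circ b-a-b$. $\mathbb{F}_p$ is the field with $p$ elements. Nilpotency index of a brace: for subsets $X,Y\subseteq A$, $X*Y$ is the set of all finite sums of elements $x*y$, $x\in X$, $y\in Y$; put $A^{[1]}=A$ and $A^{[i+1]}=\sum_{j=1}^{i}A^{[j]}*A^{[i+1-j]}$. $A$ is strongly nilpotent if some $A^{[n]}=0$, and has nilpotency index $k$ if $A^{[k]}=0$ and $A^{[k-1]}\neq0$. A pre-Lie algebra over a field is a vector space with a bilinear operation $\cdot$ satisfying $(x\cdot y)\cdot z-x\cdot(y\cdot z)=(y\cdot x)\cdot z-y\cdot(x\cdot z)$ for all $x,y,z$. It is nilpotent of nilpotency index $n$ if all products of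 any $n$ elements (with any bracketing) are zero and $n$ is minimal with this property. Group of flows: let $(A,+,\cdot)$ be a nilpotent pre-Lie algebra over $\mathbb{F}_p$ of nilpotency index $k<p$. For $a\in A$ let $L_a(b)=a\cdot b$ and $e^{L_a}(b)=b+a\cdot b+\frac1{2!}a\cdot(a\cdot b)+\frac1{3!}a\cdot(a\cdot(a\cdot b))+\cdots$, where the sum stops at place $k$ (all products of $k$ or more elements vanish). Let $W(a)=a+\frac1{2!}a\cdot a+\frac1{3!}a\cdot(a\cdot a)+\cdots$, again stopping at place $k$. The map $W:A\to A$ is bijective; let $\Omega$ be its inverse. Define $a\circ b=a+e^{L_{\Omega(a)}}(b)$. Then $(A,+,\circ)$, with the same addition, is a left brace, and $(A,\circ)$ (or the brace $(A,+,\circ)$) is called the group of flows of the pre-Lie algebra $(A,+,\cdot)$. *)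

(* Defs.v *)
From HB Require Import structures.
From mathcomp Require Import all_boot all_order all_algebra.
From mathcomp Require Import sesquilinear.
From mathcomp Require Import classical_sets.

Set Implicit Arguments.
Unset Strict Implicit.
Unset Printing Implicit Defensive.

Import GRing.Theory.
Local Open Scope ring_scope.
Local Open Scope classical_set_scope.

(* The additive group is the zmodType structure carried by [A]. *)
Record leftBrace (A : zmodType) := LeftBrace {
  circ : A -> A -> A;
  circ1 : A;
  circV : A -> A;
  circA : associative circ;
  circ1l : left_id circ1 circ;
  circ1r : right_id circ1 circ;
  circVl : left_inverse circ1 circV circ;
  circVr : right_inverse circ1 circV circ;
  circD : forall a b c, circ a (b + c) + a = circ a b + circ a c
}.

Section BraceNilpotency.
Variables (A : zmodType) (B : leftBrace A).

Definition star (a b : A) : A := circ B a b - a - b.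

Definition star_set (X Y : set A) : set A :=
  [set z | exists s : seq (A * A),
     (forall u, u \in s -> X u.1 /\ Y u.2) /\
     z = \sum_(u <- s) star u.1 u.2].

(* [\sum_(1 <= j <= i) P j * P (i + 1 - j)], with the elementwise sum of
   subsets. *)
Definition star_convolution (P : nat -> set A) (i : nat) : set A :=
  [set z | exists t : nat -> A,
     (forall j, (1 <= j <= i)%N -> star_set (P j) (P (i.+1 - j)%N) (t j)) /\
     z = \sum_(1 <= j < i.+1) t j].

(* The recursion for A^[i+1] uses all the earlier terms: [strong_series_upto n]
   has the correct values at the indices 1, ..., n+1; see [strong_series1] and
   [strong_seriesS] for the defining equations. *)
Fixpoint strong_series_upto (n : nat) : nat -> set A :=
  if n is n'.+1 then
    fun i => if (i <= n'.+1)%N then strong_series_upto n' i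
             else star_convolution (strong_series_upto n') n'.+1
  else fun=> setT.

(* A^[i], meaningful for i >= 1. *)
Definition strong_series (i : nat) : set A := strong_series_upto i.-1 i.

Lemma strong_series1 : strong_series 1 = setT.
Proof. by []. Qed.

Lemma strong_series_uptoE n i :
  (0 < i <= n.+1)%N -> strong_series_upto n i = strong_series i.
Proof.
elim: n => [|n IHn]; first by case: i => [|[|i]].
case/andP=> i_gt0; rewrite leq_eqVlt => /predU1P[-> //|].
by rewrite ltnS /= => le_i_n; rewrite le_i_n IHn ?i_gt0.
Qed.

Lemma strong_seriesS i :
  (0 < i)%N -> strong_series i.+1 = star_convolution strong_series i.
Proof.
case: i => // i _; rewrite {1}/strong_series /= ltnn.
have E j : (1 <= j <= i.+1)%N ->
  star_set (strong_series_upto i j) (strong_series_upto i (i.+2 - j)) =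
  star_set (strong_series j) (strong_series (i.+2 - j)).
  case/andP=> j_gt0 le_j_i; rewrite !strong_series_uptoE ?j_gt0 //.
  by rewrite subn_gt0 ltnS le_j_i leq_subLR -addn1 addnC leq_add2r.
apply/seteqP; split=> z [t [tP ->]]; exists t; split=> // j j_i.
  by rewrite -E //; apply: tP.
by rewrite E //; apply: tP.
Qed.

(* A^[0] is not defined, so index 1 just means A^[1] = A = 0. *)
Definition brace_nilpotency_index (k : nat) : Prop :=
  [/\ (0 < k)%N, strong_series k = [set 0]
    & (1 < k)%N -> strong_series k.-1 <> [set 0]].

End BraceNilpotency.

Record preLieAlgebra (F : fieldType) (A : lmodType F) := PreLieAlgebra {
  plmul : {bilinear A -> A -> A};
  plmulP : forall x y z,
    plmul (plmul x y) z - plmul x (plmul y z) =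
    plmul (plmul y x) z - plmul y (plmul x z)
}.

Section PreLie.
Variables (F : fieldType) (A : lmodType F) (P : preLieAlgebra A).

(* [pl_product n x]: x is a product of n elements of A, bracketed in some way. *)
Inductive pl_product : nat -> A -> Prop :=
| pl_product1 x : pl_product 1 x
| pl_productM m n x y :
    pl_product m x -> pl_product n y -> pl_product (m + n) (plmul P x y).

Definition pl_products_vanish (n : nat) : Prop :=
  forall x, pl_product n x -> x = 0.

(* Positivity is required because there are no empty products. *)
Definition prelie_nilpotency_index (n : nat) : Prop :=
  [/\ (0 < n)%N, pl_products_vanish n
    & forall m, (0 < m < n)%N -> ~ pl_products_vanish m].

(* [k] is meant to be the nilpotency index: e^{L_a}(b) and W(a) lose nothing by
   truncation at i < k since [iter i (plmul P a) b] is a product of i + 1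
   elements; the factorials are invertible in F_p as soon as k < p. *)
Definition exp_L (k : nat) (a b : A) : A :=
  \sum_(i < k) (i`!%:R : F)^-1 *: iter i (plmul P a) b.

Definition flow_W (k : nat) (a : A) : A :=
  \sum_(i < k) ((i.+1)`!%:R : F)^-1 *: iter i (plmul P a) a.

(* [Omega] is the two-sided inverse of [flow_W k], hence unique. *)
Definition is_group_of_flows (k : nat) (B : leftBrace A) : Prop :=
  exists Omega : A -> A,
    [/\ cancel (flow_W k) Omega, cancel Omega (flow_W k)
      & forall a b, circ B a b = a + exp_L k (Omega a) b].

End PreLie.

(* Main.v *)
Require Import Defs.
From mathcomp Require Import all_boot all_order all_algebra.
From mathcomp Require Import finfield sesquilinear classical_sets.

(** Replace a by a multiple t a with t in F_p, and expand (t a) * b =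
    e^{L_{Omega(t a)}}(b) - b in powers of t. The map Omega is given by a
    universal expression in products of copies of a, with linear part a, so
    (t a) * b is a sum of terms t^j c_j with j >= 1, where c_1 = a . b and c_j
    is a combination of products of at least j elements. Nilpotency kills c_j
    for j >= k. The functional f |-> - \sum_i 2^-i f(2^i), i < p - 1, sends
    t^j c to minus a geometric sum of ratio 2^(j-1), times c: this gives c for
    j = 1, since p - 1 = -1 in F_p, and 0 for 1 < j < k, since
    1 < 2^(j-1) < p makes the ratio different from 1 and Fermat's little
    theorem makes the sum vanish. Hence it sends t |-> (t a) * b to a . b,
    which is the formula.

    The expansion in t is never written out. Omega(a) is the k-th iterate of
    x |-> a - (W(x) - x) started at 0 ([Omega_log_iter]), because this map
    brings two points one step closer in the filtration of A by powers.
    Everything that the iteration preserves is then inherited by Omega.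
    Applied to the powers of A, this gives Omega(A^m) <= A^m, hence
    A^m * A^n <= A^(m+n) ([power_star]). Applied to functions of t of the form
    \sum_j t^j c_j with c_j in A^j and j >= v, which multiply like a
    filtration as well, it gives that (t a) * b - t (a . b) has only terms
    with j >= 2 ([curve_star]).

    For the nilpotency index, A^[n] is exactly the span A^n of the products of
    n elements: one inclusion is [power_star], and the other follows by
    applying the formula to each product, as the A^[n] are additive subgroups
    and F_p-multiples are integer multiples. *)

Set Implicit Arguments.
Unset Strict Implicit.
Unset Printing Implicit Defensive.

Import GRing.Theory.
Local Open Scope ring_scope.

(** * The filtration by powers *)

Section Powers.
Variables (F : fieldType) (A : lmodType F) (P : preLieAlgebra A).

Definition power (n : nat) (x : A) : Prop :=
  exists s : seq A, (forall u, u \in s -> pl_product P n u) /\ x = \sum_(u <- s) u.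

Lemma pl_product_gt0 n x : pl_product P n x -> (0 < n)%N.
Proof. by elim=> // m n' ? ? _ m_gt0 _ _; rewrite addn_gt0 m_gt0. Qed.

(** A subproduct of two elements can be read as a single element, which
    shortens the product by one factor. *)
Lemma pl_product_le m n x :
  (0 < m <= n)%N -> pl_product P n x -> pl_product P m x.
Proof.
move=> /andP[m_gt0 le_mn] Pnx; elim: Pnx m m_gt0 le_mn => {n x}.
  by move=> x [|[|m]] // _ _; constructor.
move=> n1 n2 x y Px IHx Py IHy [//|[_ _|m _ le_m]]; first by constructor.
have [n1_gt0 n2_gt0] := (pl_product_gt0 Px, pl_product_gt0 Py).
have [le_m_n2|lt_n2_m] := leqP m.+1 n2.
  by rewrite -[m.+2]add1n; constructor; [apply: IHx | apply: IHy].
rewrite -(subnK (leqW (ltnW lt_n2_m))); constructor => //.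
apply: IHx; first by rewrite subn_gt0 leqW.
by rewrite leq_subLR addnC.
Qed.

Lemma pl_productZ n c x : pl_product P n x -> pl_product P n (c *: x).
Proof.
move=> Px; elim: Px c => {n x} [x c|m n x y _ IHx Py _ c]; first by constructor.
by rewrite -linearZl_LR; constructor.
Qed.

Lemma power_product n x : pl_product P n x -> power n x.
Proof.
by move=> Px; exists [:: x]; rewrite big_seq1; split=> // u /[!inE] /eqP->.
Qed.

Lemma power1 x : power 1 x.
Proof. by apply: power_product; constructor. Qed.

Lemma power0 n : power n 0.
Proof. by exists [::]; rewrite big_nil. Qed.

Lemma powerD n x y : power n x -> power n y -> power n (x + y).
Proof.
move=> [s [Ps ->]] [s' [Ps' ->]]; exists (s ++ s'); rewrite big_cat; split=> // u.
by rewrite mem_cat => /orP[/Ps|/Ps'].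
Qed.

Lemma power_sum n (I : eqType) (r : seq I) (f : I -> A) :
  (forall i, i \in r -> power n (f i)) -> power n (\sum_(i <- r) f i).
Proof.
by move=> Pf; rewrite big_seq; elim/big_ind: _ => //;
  [apply: power0 | apply: powerD].
Qed.

Lemma powerZ n c x : power n x -> power n (c *: x).
Proof.
move=> [s [Ps ->]]; rewrite scaler_sumr; apply: power_sum => u /Ps Pu.
by apply/power_product/pl_productZ.
Qed.

Lemma powerM m n x y : power m x -> power n y -> power (m + n) (plmul P x y).
Proof.
move=> [s [Ps ->]] [s' [Ps' ->]]; rewrite linear_sumlz; apply: power_sum => u /Ps Pu.
rewrite linear_sumr; apply: power_sum => v /Ps' Pv.
by apply: power_product; constructor.
Qed.

Lemma power_le m n x : (0 < m <= n)%N -> power n x -> power m x.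
Proof.
move=> le_mn [s [Ps ->]]; apply: power_sum => u /Ps Pu.
exact/power_product/(pl_product_le le_mn).
Qed.

Lemma power_eq0 k n x :
  (0 < k)%N -> pl_products_vanish P k -> (k <= n)%N -> power n x -> x = 0.
Proof.
move=> k_gt0 Pk le_kn [s [Ps ->]]; rewrite big_seq big1 // => u /Ps Pu.
by apply/Pk/(pl_product_le _ Pu)/andP.
Qed.

Lemma closed_sum (T : Type) (Q : (T -> A) -> Prop)
    (Q_ext : forall f g, f =1 g -> Q f -> Q g) (Q0 : Q (fun=> 0))
    (QD : forall f g, Q f -> Q g -> Q (fun t => f t + g t))
    (I : eqType) (r : seq I) (f : I -> T -> A) :
  (forall i, i \in r -> Q (f i)) -> Q (fun t => \sum_(i <- r) f i t).
Proof.
elim: r => [|i r IHr] Qf; first by apply: Q_ext Q0 => t; rewrite big_nil.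
apply: (Q_ext (fun t => f i t + \sum_(j <- r) f j t)).
  by move=> t; rewrite big_cons.
apply: QD; first by apply: Qf; rewrite mem_head.
by apply: IHr => j rj; apply: Qf; rewrite in_cons rj orbT.
Qed.

(** The common features of the powers of A and of their version with a
    parameter [t : T]. Filtering functions of [t], and not elements, lets one
    induction over the construction of Omega serve both cases. The bound
    [0 < m] in [fil_le] is there because no products of length 0 exist. *)
Record filtration (T : Type) := Filtration {
  fil :> nat -> (T -> A) -> Prop;
  fil_ext : forall m f g, f =1 g -> fil m f -> fil m g;
  fil0 : forall m, fil m (fun=> 0);
  filD : forall m f g, fil m f -> fil m g -> fil m (fun t => f t + g t);
  filZ : forall m c f, fil m f -> fil m (fun t => c *: f t);
  filM : forall m n f g,
    fil m f -> fil n g -> fil (m + n)%N (fun t => plmul P (f t) (g t));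
  fil_le : forall m n f, (0 < m <= n)%N -> fil n f -> fil m f
}.

Definition power_filtration : filtration unit.
Proof.
apply: (@Filtration _ (fun m f => power m (f tt))).
- by move=> m f g ->.
- by move=> m; apply: power0.
- by move=> m f g; apply: powerD.
- by move=> m c f; apply: powerZ.
- by move=> m n f g; apply: powerM.
- by move=> m n f; apply: power_le.
Defined.

(** * Graded curves *)

(** Tying the exponent of t to the depth of the coefficient is what makes the
    terms of degree k and more vanish in a nilpotent algebra. *)
Definition curve (v : nat) (f : F -> A) : Prop :=
  exists s : seq (nat * A),
    (forall u, u \in s -> (v <= u.1)%N /\ power u.1 u.2) /\
    (forall t, f t = \sum_(u <- s) t ^+ u.1 *: u.2).

Lemma curve0 v : curve v (fun=> 0).
Proof. by exists [::]; split=> // t; rewrite big_nil. Qed.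

Lemma curve_monomial v j c :
  (v <= j)%N -> power j c -> curve v (fun t => t ^+ j *: c).
Proof.
move=> le_vj Pc; exists [:: (j, c)]; split=> [u /[!inE] /eqP-> //|t].
by rewrite big_seq1.
Qed.

Lemma curve_ext v f g : f =1 g -> curve v f -> curve v g.
Proof. by move=> fg [s [Ps Es]]; exists s; split=> // t; rewrite -fg. Qed.

Lemma curveD v f g : curve v f -> curve v g -> curve v (fun t => f t + g t).
Proof.
move=> [s [Ps Es]] [s' [Ps' Es']]; exists (s ++ s'); split=> [u|t].
  by rewrite mem_cat => /orP[/Ps|/Ps'].
by rewrite big_cat Es Es'.
Qed.

Lemma curve_sum v (I : eqType) (r : seq I) (f : I -> F -> A) :
  (forall i, i \in r -> curve v (f i)) -> curve v (fun t => \sum_(i <- r) f i t).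
Proof. exact: closed_sum (@curve_ext v) (curve0 v) (@curveD v) _ r f. Qed.

Lemma curveZ v c f : curve v f -> curve v (fun t => c *: f t).
Proof.
move=> [s [Ps Es]].
apply: (@curve_ext _ (fun t => \sum_(u <- s) t ^+ u.1 *: (c *: u.2))).
  by move=> t; rewrite Es scaler_sumr; apply: eq_bigr => u _; rewrite !scalerA mulrC.
apply: curve_sum => u /Ps[le_v Pu].
by apply: curve_monomial => //; apply: powerZ.
Qed.

Lemma curveM v w f g :
  curve v f -> curve w g -> curve (v + w) (fun t => plmul P (f t) (g t)).
Proof.
move=> [s [Ps Es]] [s' [Ps' Es']].
apply: (@curve_ext _ (fun t => \sum_(x <- s) \sum_(y <- s')
          t ^+ (x.1 + y.1) *: plmul P x.2 y.2)).
  move=> t; rewrite Es Es' linear_sumlz; apply: eq_bigr => x _.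
  rewrite linear_sumr; apply: eq_bigr => y _.
  by rewrite linearZl_LR linearZr_LR scalerA exprD.
apply: curve_sum => x /Ps[le_v Px]; apply: curve_sum => y /Ps'[le_w Py].
by apply: curve_monomial; [apply: leq_add | apply: powerM].
Qed.

Lemma curve_le v w f : (v <= w)%N -> curve w f -> curve v f.
Proof.
move=> le_vw [s [Ps Es]]; exists s; split=> // u /Ps[le_w Pu].
by split=> //; apply: leq_trans le_w.
Qed.

(** The constant function [b] is not a curve of positive valuation, but
    multiplication by [b] on the right moves coefficients only deeper. *)
Lemma curve_mulr v f b : (0 < v)%N -> curve v f -> curve v (fun t => plmul P (f t) b).
Proof.
move=> v_gt0 [s [Ps Es]].
apply: (@curve_ext _ (fun t => \sum_(u <- s) t ^+ u.1 *: plmul P u.2 b)).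
  by move=> t; rewrite Es linear_sumlz; apply: eq_bigr => u _; rewrite linearZl_LR.
apply: curve_sum => u /Ps[le_v Pu]; apply: curve_monomial => //.
apply: (@power_le _ (u.1 + 1)); last by apply: powerM => //; apply: power1.
by rewrite leq_addr (leq_trans v_gt0).
Qed.

Definition curve_filtration : filtration F.
Proof.
apply: (@Filtration _ curve).
- exact: curve_ext.
- exact: curve0.
- exact: curveD.
- exact: curveZ.
- exact: curveM.
- by move=> m n f /andP[_]; apply: curve_le.
Defined.

(** * Omega as an iterated approximation *)

Section Filtered.
Variables (T : Type) (G : filtration T).

Lemma fil_sum m (I : eqType) (r : seq I) (f : I -> T -> A) :
  (forall i, i \in r -> G m (f i)) -> G m (fun t => \sum_(i <- r) f i t).
Proof. exact: closed_sum (@fil_ext _ G m) (fil0 G m) (@filD _ G m) _ r f. Qed.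

Lemma fil_iter m n i f g :
  G m f -> G n g -> G (i * m + n)%N (fun t => iter i (plmul P (f t)) (g t)).
Proof.
move=> Gf Gg; elim: i => [//|i IHi]; rewrite mulSn -addnA /=.
exact: filM.
Qed.

End Filtered.

(** This is W(x) - x, so that y = Omega(a) satisfies
    y = a - [flow_correction] y. *)
Definition flow_correction (k : nat) (x : A) : A :=
  \sum_(1 <= i < k) ((i.+1)`!%:R : F)^-1 *: iter i (plmul P x) x.

(** Successive approximations of the solution Omega(a) of this equation. *)
Fixpoint log_iter (k n : nat) (a : A) : A :=
  if n is n'.+1 then a - flow_correction k (log_iter k n' a) else 0.

Lemma fil_flow_correction T (G : filtration T) k m f :
  (0 < m)%N -> G m f -> G m.+1 (fun t => flow_correction k (f t)).
Proof.
move=> m_gt0 Gf; apply: fil_sum => i; rewrite mem_index_iota => /andP[i_gt0 _].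
apply: filZ; apply: fil_le (fil_iter i Gf Gf).
by rewrite /= -add1n leq_add2r muln_gt0 i_gt0.
Qed.

Lemma fil_log_iter T (G : filtration T) k n m f :
  (0 < m)%N -> G m f -> G m (fun t => log_iter k n (f t)).
Proof.
move=> m_gt0 Gf; elim: n => [|n IHn] /=; first exact: fil0.
apply: filD => //.
apply: (@fil_ext _ _ _ (fun t => -1 *: flow_correction k (log_iter k n (f t)))).
  by move=> t; rewrite scaleN1r.
apply/filZ/(@fil_le _ _ _ m.+1); first by rewrite m_gt0 leqnSn.
exact: fil_flow_correction.
Qed.

(** Telescoping: x . u - y . v = (x - y) . u + y . (u - v). *)
Lemma power_iter_sub m i x y :
  (0 < m)%N -> power m (x - y) ->
  power (m + i)%N (iter i (plmul P x) x - iter i (plmul P y) y).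
Proof.
move=> m_gt0 Pxy; elim: i => [|i IHi] /=; first by rewrite addn0.
set u := iter i _ x in IHi *; set v := iter i _ y in IHi *.
have -> : plmul P x u - plmul P y v = plmul P (x - y) u + plmul P y (u - v).
  by rewrite linearBl linearBr addrA subrK.
have Pu : power i.+1 u.
  rewrite -addn1 -[i in power (i + _)]muln1.
  by apply: (@fil_iter _ power_filtration 1 1 i (fun=> x) (fun=> x)); apply: power1.
apply: powerD; first exact: powerM.
by rewrite addnS -add1n; apply: powerM => //; apply: power1.
Qed.

(** The map x |-> W(x) - x is a contraction for the filtration by powers, since
    all its terms are products of at least two factors x. *)
Lemma power_flow_correction_sub k m x y :
  (0 < m)%N -> power m (x - y) ->
  power m.+1 (flow_correction k x - flow_correction k y).
Proof.
move=> m_gt0 Pxy; rewrite -sumrB; apply: power_sum => i.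
rewrite mem_index_iota => /andP[i_gt0 _]; rewrite -scalerBr; apply: powerZ.
apply: power_le (power_iter_sub i m_gt0 Pxy).
by rewrite /= -[m.+1]addn1 leq_add2l.
Qed.

Lemma flow_WE k x : (0 < k)%N -> flow_W P k x = x + flow_correction k x.
Proof.
move=> k_gt0; rewrite /flow_W -(big_mkord xpredT
  (fun i => ((i.+1)`!%:R)^-1 *: iter i (plmul P x) x)).
by rewrite big_ltn // (factS 0) fact0 muln1 invr1 scale1r.
Qed.

Lemma exp_LE k x b :
  (1 < k)%N -> exp_L P k x b = b + plmul P x b +
    \sum_(2 <= i < k) (i`!%:R : F)^-1 *: iter i (plmul P x) b.
Proof.
move=> k_gt1; rewrite /exp_L -(big_mkord xpredT
  (fun i => (i`!%:R)^-1 *: iter i (plmul P x) b)).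
by rewrite (big_ltn (ltnW k_gt1)) big_ltn // fact0 invr1 !scale1r addrA.
Qed.

(** * The star operation of the group of flows *)

Section Flows.
Variables (k : nat) (k_gt0 : (0 < k)%N) (P_nil : pl_products_vanish P k).
Variables (B : leftBrace A) (Omega : A -> A).
Hypothesis OmegaK : cancel Omega (flow_W P k).
Hypothesis circE : forall a b, circ B a b = a + exp_L P k (Omega a) b.

Lemma Omega_log_iter a : Omega a = log_iter k k a.
Proof.
suff PO n : power n.+1 (Omega a - log_iter k n a).
  by apply/subr0_eq/(power_eq0 k_gt0 P_nil _ (PO k)).
elim: n => [|n IHn]; first exact: power1.
have -> : Omega a - log_iter k n.+1 a =
    -1 *: (flow_correction k (Omega a) - flow_correction k (log_iter k n a)).
  have aE : a = Omega a + flow_correction k (Omega a) by rewrite -flow_WE.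
  set c := flow_correction k (Omega a) in aE *.
  by rewrite /= opprB [in - a]aE opprD addrCA addNKr scaleN1r opprB.
by apply: powerZ; apply: power_flow_correction_sub.
Qed.

Lemma power_Omega m a : (0 < m)%N -> power m a -> power m (Omega a).
Proof.
move=> m_gt0 Pa; rewrite Omega_log_iter.
exact: (@fil_log_iter _ power_filtration k k m (fun=> a)).
Qed.

(** The last step of the iteration subtracts from t a the correction of a curve
    of valuation 1, which has valuation 2. *)
Lemma curve_Omega a : curve 2 (fun t => Omega (t *: a) - t *: a).
Proof.
have Ca : curve_filtration 1 (fun t => t *: a).
  by apply: (@curve_monomial 1 1) => //; apply: power1.
have := fil_flow_correction k (ltn0Sn 0) (fil_log_iter k k.-1 (ltn0Sn 0) Ca).
move/(filZ (-1)); apply: fil_ext => t.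
have -> : Omega (t *: a) = t *: a - flow_correction k (log_iter k k.-1 (t *: a)).
  by rewrite Omega_log_iter; case: (k) k_gt0.
by rewrite scaleN1r [RHS]addrAC subrr add0r.
Qed.

Lemma starE a b : star B a b = exp_L P k (Omega a) b - b.
Proof. by rewrite /star circE [a + _]addrC addrK. Qed.

Lemma power_star m n a b :
  (0 < m)%N -> power m a -> power n b -> power (m + n) (star B a b).
Proof.
move=> m_gt0 Pa Pb.
rewrite starE /exp_L -(big_mkord xpredT
  (fun i => (i`!%:R)^-1 *: iter i (plmul P (Omega a)) b)) big_ltn //.
rewrite invr1 scale1r addrC addKr; apply: power_sum => i.
rewrite mem_index_iota => /andP[i_gt0 _]; apply: powerZ.
apply: (@power_le _ (i * m + n)).
  by rewrite addn_gt0 m_gt0 leq_add2r leq_pmull.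
apply: (@fil_iter _ power_filtration m n i (fun=> _) (fun=> b)) => //.
exact: power_Omega.
Qed.

(** The two sources of terms of degree at least 2 are the nonlinear part of
    Omega(t a) in Omega(t a) . b, and the iterates of L_{Omega(t a)} beyond the
    first. *)
Lemma curve_star a b :
  (1 < k)%N -> curve 2 (fun t => star B (t *: a) b - t *: plmul P a b).
Proof.
move=> k_gt1.
have CO : curve 1 (fun t => Omega (t *: a)).
  have Ca : curve 1 (fun t => t *: a).
    by apply: (@curve_monomial 1 1) => //; apply: power1.
  apply: curve_ext (curveD Ca (curve_le (leqnSn 1) (curve_Omega a))) => t.
  by rewrite addrC subrK.
apply: (@curve_ext _ (fun t => plmul P (Omega (t *: a) - t *: a) b +
   \sum_(2 <= i < k) (i`!%:R : F)^-1 *: iter i (plmul P (Omega (t *: a))) b)).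
  move=> t; rewrite starE exp_LE // linearBl linearZl_LR.
  by rewrite -[b + _ + _]addrA [b + _]addrC addrK addrAC.
apply: curveD; first by apply: curve_mulr => //; apply: curve_Omega.
apply: curve_sum => -[|[|i]]; rewrite mem_index_iota // => _; apply: curveZ.
apply: (@curve_ext _ (fun t => iter i.+1 (plmul P (Omega (t *: a)))
                                 (plmul P (Omega (t *: a)) b))).
  by move=> t; rewrite -iterSr.
apply: (@curve_le _ (i.+1 * 1 + 1)); first by rewrite muln1 addn1.
by apply: (@fil_iter _ curve_filtration) => //; apply: curve_mulr.
Qed.

End Flows.
End Powers.

(** * The strong series of a brace *)

Section StrongSeries.
Variables (A : zmodType) (B : leftBrace A).

Lemma strong_series0 n : strong_series B n 0.
Proof.
case: n => [//|[//|n]]; rewrite strong_seriesS //.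
exists (fun=> 0); split=> [j _|]; last by rewrite big1.
by exists [::]; rewrite big_nil.
Qed.

Lemma strong_seriesD n x y :
  strong_series B n x -> strong_series B n y -> strong_series B n (x + y).
Proof.
case: n => [//|[//|n]]; rewrite strong_seriesS // => -[t [Pt ->]] [t' [Pt' ->]].
exists (fun j => t j + t' j); rewrite big_split; split=> // j le_j.
have [[s [Ps ->]] [s' [Ps' ->]]] := (Pt j le_j, Pt' j le_j).
exists (s ++ s'); rewrite big_cat; split=> // u.
by rewrite mem_cat => /orP[/Ps|/Ps'].
Qed.

Lemma strong_seriesMn n x m : strong_series B n x -> strong_series B n (x *+ m).
Proof.
move=> Sx; elim: m => [|m IHm]; first by rewrite mulr0n; apply: strong_series0.
by rewrite mulrS; apply: strong_seriesD.
Qed.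

(** In the convolution defining A^[m+n], take the only nonzero summand at
    index m. *)
Lemma strong_series_star m n x y :
  (0 < m)%N -> (0 < n)%N -> strong_series B m x -> strong_series B n y ->
  strong_series B (m + n) (star B x y).
Proof.
case: n => // n m_gt0 _ Sx Sy.
rewrite addnS strong_seriesS ?addn_gt0 ?m_gt0 //.
exists (fun j => if j == m then star B x y else 0); split=> [j _|].
  case: eqP => [->|_]; last by exists [::]; rewrite big_nil.
  exists [:: (x, y)]; rewrite big_seq1; split=> // u /[!inE] /eqP-> /=.
  by rewrite -addnS addKn.
by rewrite -big_mkcond big_nat1_eq ltnS m_gt0 leq_addr.
Qed.

End StrongSeries.

(** * Extracting the linear term over a prime field *)

Section PrimeField.
Variables (p : nat) (p_prime : prime p).
Variables (k : nat) (k_gt0 : (0 < k)%N) (lt_2k_p : (2 ^ k < p)%N).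

Lemma geometric_sum_Fp (r : 'F_p) :
  r != 0 -> \sum_(0 <= i < p.-1) r ^+ i = - (r == 1)%:R.
Proof.
move=> r_neq0; rewrite big_mkord; have [->|r_neq1] := eqVneq r 1.
  under eq_bigr do rewrite expr1n.
  rewrite sumr_const card_ord; apply/eqP; rewrite -subr_eq0 opprK -mulrSr.
  by rewrite prednK ?prime_gt0 // -(dvdn_pcharf (pchar_Fp p_prime)).
apply: (mulfI (x := r - 1)); first by rewrite subr_eq0.
apply/eqP; rewrite oppr0 mulr0 -subrX1 subr_eq0; apply/eqP/(mulfI r_neq0).
by rewrite -exprS prednK ?prime_gt0 // mulr1 -{2}(expf_card r) card_Fp.
Qed.

Lemma exp2_Fp_neq0 j : (2 ^+ j : 'F_p) != 0.
Proof.
rewrite expf_neq0 // -(dvdn_pcharf (pchar_Fp p_prime)) gtnNdvd //.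
by apply: leq_ltn_trans lt_2k_p; rewrite -{1}(expn1 2) leq_exp2l.
Qed.

Lemma exp2_Fp_neq1 j : (0 < j < k)%N -> (2 ^+ j : 'F_p) != 1.
Proof.
move=> /andP[j_gt0 lt_jk].
have two_gt1 : (1 < 2 ^ j)%N by rewrite -{1}(expn0 2) ltn_exp2l.
rewrite -subr_eq0 -natrX -(natrB _ (ltnW two_gt1)).
rewrite -(dvdn_pcharf (pchar_Fp p_prime)) gtnNdvd ?subn_gt0 //.
by rewrite (leq_ltn_trans (leq_subr _ _)) // (ltn_trans _ lt_2k_p) // ltn_exp2l.
Qed.

Variables (A : lmodType 'F_p).

Definition dyadic_sum (f : 'F_p -> A) : A :=
  - \sum_(0 <= i < p.-1) (2 ^+ i)^-1 *: f (2 ^+ i).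

Lemma dyadic_sumB f g :
  dyadic_sum (fun t => f t - g t) = dyadic_sum f - dyadic_sum g.
Proof.
rewrite /dyadic_sum -opprD -sumrB; congr (- _).
by apply: eq_bigr => i _; rewrite scalerBr.
Qed.

Lemma dyadic_sum_monomial j (c : A) :
  (0 < j <= k)%N -> dyadic_sum (fun t => t ^+ j *: c) = (j == 1%N)%:R *: c.
Proof.
case: j => // j /= le_jk; rewrite /dyadic_sum.
under eq_bigr do
  rewrite scalerA exprS mulKf ?exp2_Fp_neq0 // exprAC.
rewrite -scaler_suml geometric_sum_Fp ?exp2_Fp_neq0 // scaleNr opprK eqSS.
case: j le_jk => [|j le_jk]; first by rewrite expr0 eqxx.
by rewrite (negPf (exp2_Fp_neq1 _)).
Qed.

Variable (P : preLieAlgebra A).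
Hypothesis P_nil : pl_products_vanish P k.

(** Terms of degree between 2 and k - 1 vanish by the geometric sum, those of
    degree k and more because their coefficients are zero. *)
Lemma dyadic_sum_curve f : curve P 2 f -> dyadic_sum f = 0.
Proof.
move=> [s [Ps Es]]; rewrite /dyadic_sum.
under eq_bigr do rewrite Es scaler_sumr.
rewrite exchange_big -sumrN big_seq big1 // => -[j c] /Ps[/= j_gt1 Pc].
have [le_kj|lt_jk] := leqP k j.
  rewrite (power_eq0 k_gt0 P_nil le_kj Pc).
  by rewrite big1 ?oppr0 // => i _; rewrite !scaler0.
have := @dyadic_sum_monomial j c; rewrite /dyadic_sum => -> //.
- by rewrite gtn_eqF // scale0r.
- by rewrite (ltnW lt_jk) ltnW.
Qed.

End PrimeField.

(** * Nilpotency index and recovery of the product *)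

Theorem proposition7 (p : nat) (p_prime : prime p) (k : nat)
    (lt_2k_p : (2 ^ k < p)%N) (A : lmodType 'F_p) (P : preLieAlgebra A)
    (P_index : prelie_nilpotency_index P k)
    (B : leftBrace A) (B_flows : is_group_of_flows P k B) :
  brace_nilpotency_index B k /\
  (forall a b : A,
     plmul P a b =
     - \sum_(0 <= i < p.-1) (2 ^+ i : 'F_p)^-1 *: star B (a *+ (2 ^ i)%N) b).
Proof.
case: P_index B_flows => k_gt0 P_nil P_min [Omega [_ OmegaK circE]].
have formula a b : plmul P a b =
     - \sum_(0 <= i < p.-1) (2 ^+ i : 'F_p)^-1 *: star B (a *+ (2 ^ i)%N) b.
  (* For k = 1 the algebra is zero; for k > 1 the expansion of the exponential
     has a linear term. *)
  have [k_le1|k_gt1] := leqP k 1.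
    have all0 (x : A) : x = 0 by apply: (power_eq0 k_gt0 P_nil k_le1 (power1 P x)).
    by rewrite [LHS]all0 [RHS]all0.
  have := dyadic_sum_curve p_prime k_gt0 lt_2k_p P_nil
            (curve_star k_gt0 P_nil OmegaK circE a b k_gt1).
  have := dyadic_sum_monomial p_prime k_gt0 lt_2k_p (plmul P a b) (j := 1) k_gt0.
  rewrite eqxx scale1r dyadic_sumB => -> /subr0_eq <-.
  rewrite /dyadic_sum; congr (- _); apply: eq_bigr => i _.
  by rewrite -natrX scaler_nat.
have strong_power n x : (0 < n)%N -> strong_series B n x -> power P n x.
  elim/ltn_ind: n x => -[//|[_ x _ _|n IHn x _]]; first exact: power1.
  rewrite strong_seriesS // => -[t [Pt ->]]; apply: power_sum => j.
  rewrite mem_index_iota => /andP[j_gt0 lt_j]; have [|s [Ps ->]] := Pt j.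
    by rewrite j_gt0.
  apply: power_sum => u /Ps[Su1 Su2].
  rewrite -(subnKC (ltnW lt_j)); apply: (power_star k_gt0 P_nil OmegaK circE) => //.
    exact: IHn.
  apply: IHn => //; last by rewrite subn_gt0.
  by rewrite -[X in (_ < X)%N](subnKC (ltnW lt_j)) -{1}[(_ - j)%N]add0n ltn_add2r.
have product_strong n x : pl_product P n x -> strong_series B n x.
  elim=> {n x} [//|m n x y Px Sx Py Sy]; rewrite formula -scaleN1r.
  have SZ l (c : 'F_p) z : strong_series B l z -> strong_series B l (c *: z).
    by rewrite -[c]natr_Zp scaler_nat; apply: strong_seriesMn.
  apply: (SZ); elim/big_ind: _ => [|u v|i _].
  - exact: strong_series0.
  - exact: strong_seriesD.
  - apply/SZ/strong_series_star.
    + exact: pl_product_gt0 Px.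
    + exact: pl_product_gt0 Py.
    + exact: strong_seriesMn.
    + exact: Sy.
split=> //; split=> //.
  apply/seteqP; split=> [x Sx|].
    exact: (power_eq0 k_gt0 P_nil (leqnn k) (strong_power _ _ k_gt0 Sx)).
  by move=> _ ->; apply: strong_series0.
move=> k_gt1 S0; apply: (P_min k.-1).
  by rewrite -subn1 subn_gt0 k_gt1 subn1 ltn_predL.
by move=> x /product_strong; rewrite S0.
Qed.
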